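(* For every integer $h\ge 4$, there exists a $(2h-1)$-uniform hypergraph $\mathcal H$ which has no polychromatic $3$-coloring, but all of whose $h$-heavy restricted subhypergraphs are $2$-colorable.
   Context: A hypergraph $\mathcal H=(V,E)$ is a collection $E$ of subsets of a vertex set $V$. It is $m$-uniform if all its edges have size $m$, and $h$-heavy if all its edges have size at least $h$. For $X\subset V$, the trace of $\mathcal H$ on $X$ is $\mathcal H[X]=(X,\{e\cap X:e\in E\})$. A restricted subhypergraph of $\mathcal H$ is a subhypergraph of a trace $\mathcal H[X]$ (i.e., a hypergraph on $X$ whose edges form a subfamily of the edges of $\mathcal H[X]$). A coloring of the vertices with colors $1,\dots,k$ is polychromatic if every edge contains all $k$ colors; a hypergraph is $2$-colorable if it has a polychromatic $2$-coloring, i.e., a red–blue coloring of its vertices with no monochromatic edge. *)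

(* Defs.v *)
From mathcomp Require Import all_boot.

Set Implicit Arguments.
Unset Strict Implicit.
Unset Printing Implicit Defensive.

(* A hypergraph on the finite vertex set V is
   identified with its family of edges. *)
Notation hypergraph V := {set {set V}}.

Definition uniform (V : finType) (m : nat) (H : hypergraph V) : Prop :=
  forall e : {set V}, e \in H -> #|e| = m.

Definition heavy (V : finType) (h : nat) (H : hypergraph V) : Prop :=
  forall e : {set V}, e \in H -> h <= #|e|.

(* The vertex set of the trace on X is the subtype of elements of X, so the
   edge e :&: X appears as the preimage of e under the inclusion map. *)
Definition trace (V : finType) (H : hypergraph V) (X : {set V}) :
    hypergraph {x : V | x \in X} :=
  [set [set x : {x : V | x \in X} | val x \in e] | e : {set V} in H].

Definition restricted_subhypergraph (V : finType) (H : hypergraph V)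
    (X : {set V}) (F : hypergraph {x : V | x \in X}) : Prop :=
  F \subset trace H X.

(* The k colors are the elements of 'I_k. *)
Definition polychromatic (V : finType) (k : nat) (H : hypergraph V)
    (c : V -> 'I_k) : Prop :=
  forall e : {set V}, e \in H ->
    forall i : 'I_k, exists2 v : V, v \in e & c v = i.

Definition polychromatic_colorable (V : finType) (k : nat)
    (H : hypergraph V) : Prop :=
  exists c : V -> 'I_k, polychromatic H c.

Definition two_colorable (V : finType) (H : hypergraph V) : Prop :=
  polychromatic_colorable 2 H.

(* Main.v *)
Require Import Defs.
From mathcomp Require Import all_boot zify.

(* With the (2h-1)-sets described by their complements, we need a family G of
   h-subsets ("blocks") of a set V of 3h-1 points.  In a 3-coloring some class
   has at most h-1 points, so there is no polychromatic 3-coloring as soon as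
   every (h-1)-set lies in a block.  A vertex set X with at most 2h-2 points is
   colored by any balanced bipartition.  If |X| = 2h-1, color it by R and X \ R
   with |R| = h-1: an edge of size >= h can only fail by being X \ R, that is,
   if some block meets X exactly in R.  If |X| >= 2h, color h points P of a
   2h-subset Y of X: an edge can only fail if P or Y \ P is a block.

   For G, take V to be a point o and 3h-2 other points matched into pairs, one
   being left over if h is odd.  All h-sets through o would cover every
   (h-1)-set, and would settle the sets X containing o.  For X avoiding o one
   removes the blocks R + o with R one point short of a union C of pairs (plus
   a single point if h is odd) and covers such R by the block C instead: only
   h-1 of the points other than o lie outside X, so X contains enough full pairs
   to find such an R. *)

Set Implicit Arguments.
Unset Strict Implicit.
Unset Printing Implicit Defensive.

Lemma intermediate_set (T : finType) (A B : {set T}) (k : nat) :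
  A \subset B -> #|A| <= k <= #|B| ->
  exists C : {set T}, [/\ A \subset C, C \subset B & #|C| = k].
Proof.
move=> sAB /andP[leAk lekB]; pose s := take (k - #|A|) (enum (B :\: A)).
have s_sub x : x \in s -> x \in B :\: A by move/mem_take; rewrite mem_enum.
have card_s : #|[set x in s]| = k - #|A|.
  rewrite cardsE; have /card_uniqP -> : uniq s by apply: take_uniq; exact: enum_uniq.
  by rewrite size_takel // -cardE cardsD (setIidPr sAB); lia.
exists (A :|: [set x in s]); split; first exact: subsetUl.
  rewrite subUset sAB; apply/subsetP=> x; rewrite inE => /s_sub.
  by rewrite inE => /andP[].
rewrite cardsU card_s disjoint_setI0 ?cards0; first by lia.
rewrite disjoint_sym disjoints_subset; apply/subsetP=> x.
by rewrite inE => /s_sub; rewrite !inE => /andP[].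
Qed.

(** * From a block family to the hypergraph of complements *)

Section Complements.

Variables (V : finType) (h : nat) (G : {set {set V}}).
Hypothesis h_gt0 : 0 < h.
Hypothesis card_block : forall B, B \in G -> #|B| = h.
Hypothesis G_avoids : forall X : {set V}, #|X| = 2 * h - 1 ->
  exists R : {set V},
    [/\ R \subset X, #|R| = h - 1 & forall B, B \in G -> B :&: X != R].
Hypothesis G_splits : forall X : {set V}, #|X| = 2 * h ->
  exists P : {set V},
    [/\ P \subset X, #|P| = h, P \notin G & X :\: P \notin G].

Definition complements : hypergraph V := [set ~: B | B in G].

Lemma complements_split (X : {set V}) :
  exists P : {set V}, forall B, B \in G -> h <= #|X :\: B| ->
    ~~ (X :\: B \subset P) /\ ~~ (X :\: B \subset X :\: P).
Proof.
have [leX|ltX] := leqP #|X| (2 * h - 2).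
  have [||P [_ sPX cardP]] := @intermediate_set _ set0 X (#|X| %/ 2).
  - exact: sub0set.
  - by rewrite cards0; lia.
  exists P => B _ leXB; split; apply: contraTN leXB => /subset_leq_card.
    by rewrite cardP -ltnNge; lia.
  by rewrite [#|X :\: P|]cardsD (setIidPr sPX) cardP -ltnNge; lia.
have [eqX|neqX] := eqVneq #|X| (2 * h - 1).
  have [R [sRX cardR R_avoids]] := G_avoids eqX.
  exists R => B GB leXB; split.
    by apply: contraTN leXB => /subset_leq_card; rewrite -ltnNge; lia.
  apply: contra (R_avoids B GB) => sXB.
  have eqXB : X :\: B = X :\: R.
    by apply/eqP; rewrite eqEcard sXB [#|X :\: R|]cardsD (setIidPr sRX); lia.
  have : X :\: (X :\: B) = X :\: (X :\: R) by rewrite eqXB.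
  by rewrite !setDDr setDv !set0U (setIidPr sRX) setIC => ->.
have [||Y [_ sYX cardY]] := @intermediate_set _ set0 X (2 * h).
- exact: sub0set.
- by rewrite cards0; lia.
have [P [sPY cardP GP GYP]] := G_splits cardY.
have sPX := subset_trans sPY sYX.
exists P => B GB leXB; split.
  (* All of [X :\: P] lies in [B], so [Y :\: P] does too, and both have [h] points. *)
  apply: contra GYP => sXBP.
  have sXPB : X :\: P \subset B.
    by rewrite subDset setUC -subDset.
  suff /eqP -> : Y :\: P == B by [].
  rewrite eqEcard (subset_trans (setSD _ sYX) sXPB) (card_block GB).
  by rewrite cardsD (setIidPr sPY) cardY cardP; lia.
(* The edge misses [P], so [P] lies in [B], and both have [h] points. *)
apply: contra GP => sXBXP; suff /eqP -> : P == B by [].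
rewrite eqEcard (card_block GB) cardP leqnn andbT; apply/subsetP => x Px.
apply: contraTT Px => nBx; have [Xx|] := boolP (x \in X).
  have : x \in X :\: P by apply: (subsetP sXBXP); rewrite inE nBx.
  by rewrite inE => /andP[].
by apply: contra => /(subsetP sPX).
Qed.

Lemma complements_restricted (X : {set V}) (F : hypergraph {x : V | x \in X}) :
  restricted_subhypergraph complements F -> heavy h F -> two_colorable F.
Proof.
move=> sF heavyF; have [P splitP] := complements_split X.
exists (fun x => if val x \in P then ord0 else lift ord0 ord0) => e Fe.
have /imsetP[_ /imsetP[B GB ->] def_e] := subsetP sF e Fe.
have eE : [set val x | x in e] = X :\: B.
  apply/setP=> v; apply/imsetP/setDP.
    by case=> x; rewrite def_e !inE => nBx ->; split=> //; exact: (valP x).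
  by case=> Xv nBv; exists (exist _ v Xv); rewrite // def_e !inE.
have [|nP nXP] := splitP B GB.
  by rewrite -eE card_imset ?heavyF //; exact: val_inj.
have pick (Q : {set V}) : ~~ (X :\: B \subset Q) -> exists2 x, x \in e & val x \notin Q.
  by rewrite -eE => /subsetPn[_ /imsetP[x ex ->]]; exists x.
case; case=> [|[|//]] i_lt.
  have [x ex nx] := pick _ nXP; exists x => //.
  by move: nx; rewrite inE (valP x) andbT negbK => ->; apply: val_inj.
have [x ex nx] := pick _ nP; exists x => //.
by rewrite (negbTE nx); apply: val_inj.
Qed.

Hypothesis cardV : #|V| = 3 * h - 1.

Lemma complements_uniform : uniform (2 * h - 1) complements.
Proof.
by move=> _ /imsetP[B GB ->]; have := cardsC B; rewrite cardV (card_block GB); lia.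
Qed.

Hypothesis G_covers : forall Q : {set V}, #|Q| = h - 1 ->
  exists2 B, B \in G & Q \subset B.

Lemma complements_not_3colorable : ~ polychromatic_colorable 3 complements.
Proof.
case=> c c_poly; pose C i := [set v | c v == i].
(* Three classes of at least [h] points would need more than [3 * h - 1] points. *)
have [i leCi] : exists i, #|C i| <= h - 1.
  apply/existsP; apply/contraT; rewrite negb_exists => /forallP ltC.
  have : \sum_i #|C i| = #|V|.
    rewrite -sum1_card (partition_big c predT) //=; apply: eq_bigr => i _.
    by rewrite -sum1_card; apply: eq_bigl => v; rewrite inE.
  rewrite !big_ord_recl big_ord0 cardV.
  move: (ltC ord0) (ltC (lift ord0 ord0)) (ltC (lift ord0 (lift ord0 ord0))).
  lia.
have [||Q [sCQ _ cardQ]] := @intermediate_set _ (C i) setT (h - 1).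
- exact: subsetT.
- by rewrite leCi cardsT cardV; lia.
have [B GB sQB] := G_covers cardQ.
have [v] := c_poly (~: B) (imset_f _ GB) i.
rewrite inE => /negP nBv cvi; apply: nBv.
by apply/(subsetP sQB)/(subsetP sCQ); rewrite inE cvi.
Qed.

End Complements.

(** * Blocks on a set of paired points *)

Section PairedPoints.

Variables (V : finType) (h : nat) (o : V) (p : V -> V) (L : {set V}).
Hypothesis h_ge4 : 4 <= h.
Hypothesis cardV : #|V| = 3 * h - 1.
Hypothesis pK : involutive p.
Hypothesis p_o : p o = o.
Hypothesis pL_notin : forall x, x \in L -> p x \notin L.
Hypothesis p_notin_L : forall x, x \notin L -> p x != x -> p x \in L.

Definition fixpts : {set V} := [set x | (p x == x) && (x != o)].

Hypothesis card_fixpts : #|fixpts| <= odd h.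

(* The leftover point of the matching is fixed by [p]; it counts as
   unmatched. *)
Definition single (B : {set V}) : {set V} :=
  [set x in B | (p x \notin B) || (p x == x)].

(** On an [h]-set parity makes this exact: a union of pairs, with one extra single point if [h] is
    odd. *)
Definition balanced (B : {set V}) : bool := #|single B| <= odd h.

(* Requiring the unmatched points to lie outside [L] ensures that an (h-1)-set
   through [o] is in a block: add a point of [L] whose pair the set misses. *)
Definition reduced (Q : {set V}) : bool :=
  [disjoint single Q & L] &&
  [exists q, [&& q \notin Q, q != o & balanced (q |: Q)]].

Definition blocks : {set {set V}} :=
  [set B : {set V} | (#|B| == h) &&
     (if o \in B then ~~ reduced (B :\ o) else balanced B)].

Definition full (X : {set V}) : {set V} := [set x in X | p x \in X].

(** [L] has one point of each pair; [M] has the other, and the leftover point if there is one. *)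
Let M : {set V} := ~: (o |: L).

Let p_inj : injective p := inv_inj pK.

(** * Counting points and pairs *)

Lemma o_notin_L : o \notin L.
Proof. by apply/negP => Lo; have := pL_notin Lo; rewrite p_o Lo. Qed.

Lemma p_neq_o x : x != o -> p x != o.
Proof. by apply: contra => /eqP px; rewrite -(pK x) px p_o. Qed.

Lemma pL_in_M x : x \in L -> p x \in M.
Proof.
move=> Lx; rewrite !inE negb_or pL_notin // andbT p_neq_o //.
by apply: contraTneq Lx => ->; exact: o_notin_L.
Qed.

Lemma pL_fixed x : x \in L -> p x \in L -> p x = x.
Proof. by move/pL_notin/negbTE->. Qed.

Lemma pM_fixed x : x \in M -> p x \in M -> p x = x.
Proof.
rewrite !inE !negb_or => /andP[_ nLx] /andP[_ nLpx].
by apply: contraNeq nLpx => /(p_notin_L nLx).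
Qed.

Lemma M_nonfixed x : x \in M -> x \notin fixpts -> p x != x.
Proof. by rewrite !inE !negb_or negb_and => /andP[-> _]; rewrite orbF. Qed.

Lemma card_L_M : #|L| + #|M| = 3 * h - 2.
Proof. by have := cardsC (o |: L); rewrite cardV cardsU1 o_notin_L -/M; lia. Qed.

Lemma card_L_le_M : #|L| <= #|M|.
Proof.
rewrite -(card_imset _ p_inj); apply/subset_leq_card/subsetP => _ /imsetP[x Lx ->].
exact: pL_in_M.
Qed.

Lemma card_M_le_L : #|M| <= #|L| + odd h.
Proof.
apply: (@leq_trans #|p @: L :|: fixpts|).
  apply/subset_leq_card/subsetP => x Mx; rewrite inE orbC.
  have [//|nfx /=] := boolP (x \in fixpts).
  rewrite -(pK x) imset_f // p_notin_L ?M_nonfixed //.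
  by move: Mx; rewrite !inE negb_or => /andP[].
by rewrite cardsU card_imset //; move: card_fixpts; lia.
Qed.

(** If [x] in [A] is not in [full X], then [x] or [p x] is one of the points outside [o |: X]. Since
    [A] never contains both points of a pair, [f] recovers [x] from that point. This is used with
    [A] equal to [M] and to [L]. *)
Lemma card_full (A X : {set V}) :
    o \notin A -> (forall x, x \in A -> p x \in A -> p x = x) -> o \notin X ->
  #|A| + #|X| <= #|A :&: full X| + (3 * h - 2).
Proof.
move=> oA pA oX; pose f y := if y \in A then y else p y.
have sub : A :\: full X \subset f @: ~: (o |: X).
  apply/subsetP => x; rewrite !inE negb_and => /andP[nfull Ax].
  have [Xx|nXx] := boolP (x \in X); last first.
    apply/imsetP; exists x; last by rewrite /f Ax.
    by rewrite !inE negb_or nXx andbT; apply: contraTneq Ax => ->.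
  rewrite Xx /= in nfull; apply/imsetP; exists (p x).
    by rewrite !inE negb_or nfull andbT p_neq_o //; apply: contraTneq Ax => ->.
  by rewrite /f; case: ifP => [/(pA _ Ax)->|]; rewrite ?pK.
have := leq_trans (subset_leq_card sub) (leq_imset_card _ _).
have := cardsC (o |: X); rewrite cardV cardsU1 oX cardsD.
have := subset_leq_card (subsetIl A (full X)); lia.
Qed.

Lemma in_blocks_o (B : {set V}) :
  o \in B -> (B \in blocks) = (#|B| == h) && ~~ reduced (B :\ o).
Proof. by rewrite inE => ->. Qed.

Lemma in_blocks_no (B : {set V}) :
  o \notin B -> (B \in blocks) = (#|B| == h) && balanced B.
Proof. by rewrite inE => /negbTE->. Qed.

Lemma not_balanced (S B : {set V}) :
  odd h < #|S| -> S \subset single B -> ~~ balanced B.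
Proof. by move=> ltS /subset_leq_card leS; rewrite -ltnNge (leq_trans ltS). Qed.

(** * Covering, avoiding and splitting with the blocks *)

Lemma blocks_cover (Q : {set V}) :
  #|Q| = h - 1 -> exists2 B, B \in blocks & Q \subset B.
Proof.
move=> cardQ; have [Qo|nQo] := boolP (o \in Q).
  (* [f] sends a matched point to the [L]-point of its pair. As [Q :\ o] has only [h - 2] points,
     some pair is missed by [Q]. *)
  pose f y := if y \in L then y else p y.
  have [l Ll nl] : exists2 l, l \in L & l \notin f @: (Q :\ o).
    apply/subsetPn; apply/negP => /subset_leq_card le1.
    have := leq_trans le1 (leq_imset_card _ _).
    have := cardsD1 o Q; rewrite Qo cardQ.
    by move: card_L_M card_M_le_L; lia.
  have lo : l != o by apply: contraTneq Ll => ->; exact: o_notin_L.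
  have nQl : l \notin Q.
    by apply: contra nl => Ql; apply/imsetP; exists l; rewrite ?inE ?lo // /f Ll.
  have nQpl : p l \notin Q.
    apply: contra nl => Qpl; apply/imsetP; exists (p l).
      by rewrite !inE p_neq_o.
    by rewrite /f (negbTE (pL_notin Ll)) pK.
  exists (l |: Q); last exact: subsetUr.
  rewrite in_blocks_o ?cardsU1 ?nQl ?cardQ; last by rewrite inE Qo orbT.
  apply/andP; split; first by apply/eqP; lia.
  (* [l] is an unmatched point in [L], which rules out [reduced]. *)
  rewrite negb_and; apply/orP; left; apply/pred0Pn; exists l => /=.
  rewrite Ll andbT inE !in_setD1 !in_setU1 eqxx lo (negbTE nQpl) !orbF /=.
  by rewrite andbC orbC; case: eqVneq.
have [redQ|nredQ] := boolP (reduced Q).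
  have /andP[_ /existsP[q /and3P[nQq qo balq]]] := redQ.
  exists (q |: Q); last exact: subsetUr.
  rewrite in_blocks_no; last by rewrite !inE negb_or eq_sym qo.
  by rewrite balq andbT cardsU1 nQq cardQ; apply/eqP; lia.
exists (o |: Q); last exact: subsetUr.
rewrite in_blocks_o ?setU11 // setU1K // nredQ andbT cardsU1 nQo cardQ.
by apply/eqP; lia.
Qed.

(** Serves both avoiding and splitting: [o |: R] is no block because [R] is reduced, and neither
    [X :\: R] nor any [q |: R] with [q] outside [X] is balanced. *)
Lemma reduced_subset (X : {set V}) :
    o \notin X -> #|X| = 2 * h - 1 ->
  exists R : {set V},
    [/\ R \subset X, #|R| = h - 1, reduced R, ~~ balanced (X :\: R)
      & forall q, q \notin X -> q != o -> ~~ balanced (q |: R)].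
Proof.
move=> nXo cardX; pose D := M :&: full X.
have leD : uphalf h <= #|D|.
  have nMo : o \notin M by rewrite !inE eqxx.
  have := card_full nMo pM_fixed nXo; rewrite -/D cardX.
  move: card_L_M card_L_le_M card_M_le_L; lia.
(* [E] picks the pairs used for [R]. It avoids the leftover point unless that forces it to be all of
   [D]. *)
have [E [sED cardE nfixE]] : exists E : {set V},
    [/\ E \subset D, #|E| = uphalf h
      & E = D \/ forall x, x \in E -> x \notin fixpts].
  have [le|lt] := leqP (uphalf h) #|D :\: fixpts|.
    have [||E [_ sE cardE]] := @intermediate_set _ set0 (D :\: fixpts) (uphalf h).
    - exact: sub0set.
    - by rewrite cards0.
    exists E; split => //; first exact: subset_trans sE (subsetDl _ _).
    by right=> x /(subsetP sE); rewrite inE => /andP[].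
  exists D; split => //; last by left.
  apply/eqP; rewrite eqn_leq leD andbT.
  move: lt; rewrite cardsD; have := subset_leq_card (subsetIr D fixpts).
  by move: card_fixpts; lia.
have sEM x : x \in E -> x \in M by move/(subsetP sED); rewrite inE => /andP[].
have sEX x : x \in E -> x \in X /\ p x \in X.
  by move/(subsetP sED); rewrite !inE => /and3P[].
(* [E0] will be the unmatched part of [R], one point too large for balance. Then [R] has
   [2 * uphalf h - (odd h + 1) = h - 1] points, and completing one pair restores balance. *)
have [||E0 [sFE0 sE0E cardE0]] := @intermediate_set _ (E :&: fixpts) E (odd h).+1.
- exact: subsetIl.
- have := subset_leq_card (subsetIr E fixpts); move: card_fixpts; lia.
have nfix x : x \in E -> x \notin E0 -> p x != x.
  move=> Ex nE0x; apply: M_nonfixed; first exact: sEM.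
  by apply: contra nE0x => fx; apply: (subsetP sFE0); rewrite inE Ex.
(* [R] is the union of the pairs meeting [E], minus the [L]-points of the pairs
   meeting [E0]. *)
pose R := E :|: p @: (E :\: E0).
have sRX x : x \in R -> x \in X /\ p x \in X.
  case/setUP=> [/sEX //|/imsetP[y /setDP[/sEX[Xy Xpy] _] ->]].
  by rewrite pK.
have R_pE0 x : x \in E0 -> p x \in R -> p x = x.
  move=> E0x; have Mx := sEM _ (subsetP sE0E _ E0x).
  case/setUP=> [/sEM/(pM_fixed Mx) //|/imsetP[y /setDP[_ nE0y]] /p_inj eqxy].
  by rewrite -eqxy E0x in nE0y.
have singleR : single R = E0.
  apply/setP => x; rewrite inE; apply/andP/idP.
    case=> Rx; apply: contraTT => nE0x; rewrite negb_or negbK.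
    case/setUP: Rx => [Ex|/imsetP[y /setDP[Ey nE0y] ->]].
      by rewrite nfix // andbT inE imset_f ?orbT // inE nE0x.
    by rewrite pK inE Ey /= eq_sym nfix.
  move=> E0x; split; first by rewrite inE (subsetP sE0E).
  by rewrite -implybE; apply/implyP => /(R_pE0 _ E0x)->.
have [a E0a na] : exists2 a, a \in E0 & p a != a.
  have [a E0a nfa] : exists2 a, a \in E0 & a \notin fixpts.
    by apply/subsetPn; apply/negP => /subset_leq_card; move: card_fixpts; lia.
  by exists a => //; apply: M_nonfixed => //; apply/sEM/(subsetP sE0E).
have nRpa : p a \notin R by apply: contra na => /(R_pE0 _ E0a)/eqP.
have Ra : a \in R by rewrite inE (subsetP sE0E).
exists R; split.
- by apply/subsetP => x /sRX[].
- have dis : E :&: p @: (E :\: E0) = set0.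
    apply/setP => y; rewrite in_set0; apply/negP.
    case/setIP => Epx /imsetP[x /setDP[Ex nE0x] eqy]; rewrite eqy in Epx.
    by have := nfix _ Ex nE0x; rewrite (pM_fixed (sEM _ Ex) (sEM _ Epx)) eqxx.
  rewrite cardsU dis cards0 card_imset // cardsD (setIidPr sE0E) cardE cardE0.
  lia.
- rewrite /reduced singleR; apply/andP; split.
    apply/pred0Pn => -[x /andP[/= E0x Lx]].
    by have := sEM _ (subsetP sE0E _ E0x); rewrite !inE Lx orbT.
  apply/existsP; exists (p a); rewrite nRpa /=; apply/andP; split.
    by apply: contraNneq nXo => <-; case: (sEX _ (subsetP sE0E _ E0a)).
  suff /subset_leq_card : single (p a |: R) \subset E0 :\ a.
    by have := cardsD1 a E0; rewrite E0a cardE0 /balanced; lia.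
  apply/subsetP => x; rewrite inE => /andP[/setU1P[-> | Rx]].
    by rewrite pK inE Ra orbT /= eq_sym (negbTE na).
  rewrite -singleR !inE !negb_or -/R; case: (eqVneq x a) => [->|_ /=].
    by rewrite eqxx /= (negbTE na).
  by case/orP=> [/andP[_ ->]|->]; rewrite -in_setU ?Rx ?orbT // -/R.
(* If [E] avoids [fixpts], the partners of [E0] are [odd h + 1] unmatched points of [X :\: R]. *)
- case: nfixE => [eqED|nfixE]; last first.
    apply: (@not_balanced (p @: E0)); first by rewrite card_imset // cardE0.
    apply/subsetP => _ /imsetP[x E0x ->]; have Ex := subsetP sE0E _ E0x.
    have [_ Xpx] := sEX _ Ex.
    rewrite inE pK !in_setD Xpx !inE Ex /= andbT -/R andbT.
    apply: contra (M_nonfixed (sEM _ Ex) (nfixE _ Ex)) => Rpx.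
    by apply/eqP/R_pE0 => //; rewrite !inE.
  (* If [E = D], the partner of such an [x] lies outside [X], so [x] and [p a] are two unmatched
     points. *)
  have [x Xx nx] : exists2 x, x \in X & x \notin E :|: p @: E.
    apply/subsetPn; apply/negP => /subset_leq_card.
    by rewrite cardsU card_imset // cardE cardX; lia.
  have [nEx npEx] : x \notin E /\ x \notin p @: E.
    by move: nx; rewrite inE negb_or => /andP[].
  have nRx : x \notin R.
    apply: contra nx => /setUP[Ex|/imsetP[y /setDP[Ey _] ->]].
      by rewrite inE Ex.
    by rewrite inE imset_f ?orbT.
  have nXpx : p x \notin X.
    apply/negP => Xpx; have fx : x \in full X by rewrite inE Xx.
    have xo : x != o by apply: contraNneq nXo => <-.
    have [Lx|nLx] := boolP (x \in L); last first.
      by move: nEx; rewrite eqED inE fx !inE negb_or xo nLx.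
    case/negP: npEx; rewrite -(pK x) imset_f // eqED inE pL_in_M // inE pK.
    by rewrite Xx Xpx.
  apply: (@not_balanced [set p a; x]).
    rewrite cards2; have -> : p a != x; last by case: (odd h).
    by apply: contraNneq npEx => <-; rewrite imset_f // (subsetP sE0E).
  apply/subsetP => y; case/set2P=> ->.
    have [_ Xpa] := sEX _ (subsetP sE0E _ E0a).
    by rewrite inE pK !in_setD nRpa Xpa Ra.
  by rewrite inE !in_setD nRx Xx (negbTE nXpx) andbF.
(* Partners of points of [R] stay in [X], so [q] matches none of them. *)
- move=> q nXq qo; apply: (@not_balanced (q |: E0)).
    rewrite cardsU1 cardE0; have -> : q \notin E0; last by lia.
    by apply: contra nXq => /(subsetP sE0E)/sEX[].
  apply/subsetP => x /setU1P[->|E0x].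
    rewrite inE setU11 in_setU1 /= negb_or orbC.
    case: eqVneq => //= _; by apply: contra nXq => /sRX[_]; rewrite pK.
  move: (E0x); rewrite -{1}singleR inE => /andP[Rx singx].
  rewrite inE !in_setU1 Rx orbT /= negb_or.
  have -> // : p x != q.
  by apply: contraNneq nXq => <-; case: (sRX _ Rx).
Qed.

Lemma card_diff1 (X B R : {set V}) :
    #|R| = h - 1 -> B :&: X = R -> #|B| = h ->
  exists2 q, q \notin X & B = q |: R.
Proof.
move=> cardR eqR cardB; have := cardsD B X; rewrite eqR cardB cardR => cardD.
have /cards1P[q eqD] : #|B :\: X| == 1 by apply/eqP; lia.
exists q; first by have := set11 q; rewrite -eqD inE => /andP[].
by rewrite -eqR -eqD setUC setID.
Qed.

Lemma blocks_avoid (X : {set V}) :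
    #|X| = 2 * h - 1 ->
  exists R : {set V},
    [/\ R \subset X, #|R| = h - 1 & forall B, B \in blocks -> B :&: X != R].
Proof.
move=> cardX; have [Xo|nXo] := boolP (o \in X); last first.
  have [R [sRX cardR redR _ nbalR]] := reduced_subset nXo cardX.
  exists R; split => // B GB; apply/eqP => eqR.
  have cardB : #|B| = h by move: GB; rewrite inE => /andP[/eqP].
  have [q nXq eqB] := card_diff1 cardR eqR cardB.
  have nRo : o \notin R by apply: contra nXo; apply: (subsetP sRX).
  have [eqo|qo] := eqVneq q o.
    move: GB; rewrite in_blocks_o eqB eqo ?setU11 // setU1K // redR.
    by rewrite andbF.
  move: GB; rewrite in_blocks_no; last by rewrite eqB !inE negb_or eq_sym qo.
  by rewrite eqB (negbTE (nbalR q nXq qo)) andbF.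
(* [Z] contains exactly one point of each pair meeting [Y]. *)
pose Y := X :\ o; pose Z := [set x in Y | (x \notin L) || (p x \notin Y)].
have cardY : #|Y| = 2 * h - 2 by have := cardsD1 o X; rewrite Xo -/Y; lia.
have sYZ : Y \subset Z :|: p @: Z.
  apply/subsetP => x Yx; rewrite inE; have [//|nZx] := boolP (x \in Z).
  move: nZx; rewrite inE Yx /= negb_or !negbK => /andP[Lx Ypx].
  by rewrite -(pK x) imset_f // inE Ypx pL_notin.
have [||R [_ sRZ cardR]] := @intermediate_set _ set0 Z (h - 1).
- exact: sub0set.
- have := subset_leq_card sYZ; rewrite cardsU card_imset // cards0 cardY; lia.
have sZY x : x \in Z -> x \in Y by rewrite inE => /andP[].
have sRY x : x \in R -> x \in Y by move/(subsetP sRZ)/sZY.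
have R_notin_L x : x \in R -> p x \in R -> x \notin L.
  move=> Rx Rpx; have := subsetP sRZ _ Rx.
  by rewrite inE (sRY _ Rpx) orbF => /andP[].
have R_fix x : x \in R -> p x \in R -> p x = x.
  move=> Rx Rpx; have nLpx : p x \notin L by apply: R_notin_L; rewrite ?pK.
  by apply: contraNeq nLpx; apply: p_notin_L; exact: R_notin_L.
exists R; split => //; first by apply/subsetP => x /sRY; rewrite inE => /andP[].
move=> B GB; apply/eqP => eqR.
have cardB : #|B| = h by move: GB; rewrite inE => /andP[/eqP].
have [q nXq eqB] := card_diff1 cardR eqR cardB.
have nBo : o \notin B.
  apply/negP => Bo; have /sRY : o \in R by rewrite -eqR inE Bo.
  by rewrite !inE eqxx.
move: GB; rewrite in_blocks_no // => /andP[_]; apply/negP.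
(* No two points of [R] form a pair, and [q] completes at most one; [h - 2 > odd h] unmatched points
   remain. *)
apply: (@not_balanced (R :\ p q)).
  by have := cardsD1 (p q) R; rewrite cardR; lia.
apply/subsetP => x /setD1P[xpq Rx].
rewrite inE eqB !in_setU1 Rx orbT /= negb_or.
have -> /= : p x != q by apply: contraNneq xpq => <-; rewrite pK.
by rewrite -implybE; apply/implyP => /(R_fix _ Rx)->.
Qed.

Lemma blocks_split (X : {set V}) :
    #|X| = 2 * h ->
  exists P : {set V},
    [/\ P \subset X, #|P| = h, P \notin blocks & X :\: P \notin blocks].
Proof.
move=> cardX; have [Xo|nXo] := boolP (o \in X).
  have nYo : o \notin X :\ o by rewrite !inE eqxx.
  have [|R [sRY cardR redR nbal _]] := reduced_subset nYo.
    by have := cardsD1 o X; rewrite Xo; lia.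
  have nRo : o \notin R by apply: contra nYo; apply: (subsetP sRY).
  exists (o |: R); split.
  - by rewrite subUset sub1set Xo (subset_trans sRY (subsetDl _ _)).
  - by rewrite cardsU1 nRo cardR; lia.
  - by rewrite in_blocks_o ?setU11 // setU1K // redR andbF.
  rewrite in_blocks_no; last by rewrite !inE eqxx.
  by rewrite -setDDl (negbTE nbal) andbF.
(* Two pairs inside [X] are separated by [P], leaving two unmatched points on each side. *)
pose D := L :&: full X.
have leD : 2 <= #|D|.
  have := card_full o_notin_L pL_fixed nXo; rewrite -/D cardX.
  by move: card_L_M card_M_le_L; lia.
have [||T [_ sTD cardT]] := @intermediate_set _ set0 D 2.
- exact: sub0set.
- by rewrite cards0.
have TP x : x \in T -> [/\ x \in L, x \in X & p x \in X].
  by move/(subsetP sTD); rewrite !inE => /and3P[].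
have [||P [sTP sPX cardP]] := @intermediate_set _ T (X :\: p @: T) h.
- apply/subsetP => x Tx; have [Lx Xx _] := TP _ Tx; rewrite inE Xx andbT.
  apply/imsetP => -[y /TP[Ly _ _] eqx].
  by have := pL_notin Ly; rewrite -eqx Lx.
- rewrite cardT cardsD cardX; have := subset_leq_card (subsetIr X (p @: T)).
  by rewrite card_imset // cardT; lia.
have nPpT x : x \in T -> p x \notin P.
  by move=> Tx; apply/negP => /(subsetP sPX); rewrite inE imset_f.
exists P; split => //; first exact: subset_trans sPX (subsetDl _ _).
  have nPo : o \notin P.
    by apply: contra nXo => /(subsetP sPX); rewrite inE => /andP[].
  rewrite in_blocks_no // negb_and; apply/orP; right.
  apply: (@not_balanced T); first by rewrite cardT; case: (odd h).
  by apply/subsetP => x Tx; rewrite inE (subsetP sTP) // nPpT.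
rewrite in_blocks_no; last by rewrite inE negb_and nXo orbT.
rewrite negb_and; apply/orP; right; apply: (@not_balanced (p @: T)).
  by rewrite card_imset // cardT; case: (odd h).
apply/subsetP => _ /imsetP[x Tx ->]; have [_ _ Xpx] := TP _ Tx.
by rewrite inE pK !in_setD Xpx nPpT // (subsetP sTP).
Qed.

End PairedPoints.

(** * A concrete pairing and the conclusion *)

(* On [0 .. m], pairs [2i+1] with [2i+2]; [0], and [m] when [m] is odd, are
   fixed. *)
Definition partner (m x : nat) : nat :=
  if odd x then (if x < m then x.+1 else x) else x.-1.

Lemma partner_lt (m : nat) (x : 'I_m.+1) : partner m x < m.+1.
Proof. by have := ltn_ord x; rewrite /partner; do 2?case: ifP; lia. Qed.

Definition ord_partner (m : nat) (x : 'I_m.+1) : 'I_m.+1 :=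
  Ordinal (partner_lt x).

(** Plays the role of [L]: the even point of each pair. *)
Definition low (m : nat) : {set 'I_m.+1} := [set x : 'I_m.+1 | (0 < x) && ~~ odd x].

Lemma ord_partnerK (m : nat) : involutive (@ord_partner m).
Proof.
move=> x; apply: val_inj => /=; have := ltn_ord x; rewrite /partner.
by do ![case: ifP]; lia.
Qed.

Lemma ord_partner0 (m : nat) : ord_partner (ord0 : 'I_m.+1) = ord0.
Proof. exact: val_inj. Qed.

Lemma ord_partner_low (m : nat) (x : 'I_m.+1) :
  x \in low m -> ord_partner x \notin low m.
Proof. by rewrite !inE /= /partner; case: ifP; lia. Qed.

Lemma ord_partner_notin_low (m : nat) (x : 'I_m.+1) :
  x \notin low m -> ord_partner x != x -> ord_partner x \in low m.
Proof. by rewrite !inE -val_eqE /= /partner; do 2?case: ifP; lia. Qed.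

(** Only the last point [3 * h - 2] can be fixed besides [0], and it has the parity of [h]. *)
Lemma card_fixpts_partner (h : nat) : 0 < h ->
  #|fixpts (ord0 : 'I_(3 * h - 2).+1) (@ord_partner _)| <= odd h.
Proof.
move=> h_gt0; set F := fixpts _ _.
have fixE x : x \in F -> x = 3 * h - 2 :> nat /\ odd h.
  have := ltn_ord x.
  by rewrite inE -!val_eqE /= /partner; do 2?case: ifP; lia.
have [->|[x Fx]] := set_0Vmem F; first by rewrite cards0.
have [_ ->] := fixE _ Fx; apply/card_le1_eqP => y z /fixE[yE _] /fixE[zE _].
by apply: val_inj; rewrite /= yE zE.
Qed.

Theorem theorem2 :
  forall h : nat, 4 <= h ->
  exists (V : finType) (H : hypergraph V),
    [/\ uniform (2 * h - 1) H,
        ~ polychromatic_colorable 3 H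
      & forall (X : {set V}) (F : hypergraph {x : V | x \in X}),
          restricted_subhypergraph H F -> heavy h F -> two_colorable F].
Proof.
move=> h h_ge4; have h_gt0 : 0 < h by lia.
have cardV : #|'I_(3 * h - 2).+1| = 3 * h - 1 by rewrite card_ord; lia.
pose pK := @ord_partnerK (3 * h - 2); pose p0 := ord_partner0 (3 * h - 2).
pose pL := @ord_partner_low (3 * h - 2).
pose pnL := @ord_partner_notin_low (3 * h - 2).
have cF := card_fixpts_partner h_gt0.
pose G := blocks h ord0 (@ord_partner (3 * h - 2)) (low _).
have card_block B : B \in G -> #|B| = h by rewrite inE => /andP[/eqP].
exists 'I_(3 * h - 2).+1, (complements G); split.
- exact: complements_uniform.
- apply: (complements_not_3colorable h_gt0 cardV) => Q.
  exact: (blocks_cover h_ge4 cardV pK p0 pL pnL cF).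
- have avoids := blocks_avoid h_ge4 cardV pK p0 pL pnL cF.
  have splits := blocks_split h_ge4 cardV pK p0 pL pnL cF.
  by move=> X F; exact: (complements_restricted h_gt0 card_block avoids splits).
Qed.
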